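(* Let $\alpha,\beta>0$ and consider the asymmetric annihilation process on $L\ge 1$ sites, with disorder variables $\xi_i=\prod_{j=1}^i(1-2\eta_j)$. Then in the stationary state, for $1\le i<L$, $$\langle\xi_i\rangle=\frac1{(1+2\alpha)^i},$$ and $$\langle\xi_L\rangle=\frac{\beta}{(\beta+2\alpha)(1+2\alpha)^{L-1}}.$$
   Context: The model: a continuous-time Markov chain on configurations $\eta=(\eta_1,\dots,\eta_L)\in\{0,1\}^L$ ($\eta_i=1$ if site $i$ is occupied, $0$ if empty), with parameters $\alpha,\beta>0$ and the following transitions. Bulk: for each pair of neighbouring sites $(i,i+1)$, $1\le i\le L-1$, $10\to 01$ with rate $1$ and $11\to 00$ with rate $1$. Left boundary: at site $1$, $0\to 1$ with rate $\alpha$ and $1\to 0$ with rate $\alpha$. Right boundary: at site $L$, $1\to0$ with rate $\beta$. The bracket $\langle\cdot\rangle$ denotes expectation with respect to the unique stationary distribution of this chain. The disorder variable $\xi_i=\prod_{j=1}^i(1-2\eta_j)$ is $+1$ or $-1$ according to whether the number of occupied sites among $1,\dots,i$ is even or odd. *)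

(* Defs.v *)
From HB Require Import structures.
From mathcomp Require Import all_boot all_order all_algebra.
From mathcomp Require Import reals.
Set Implicit Arguments.
Unset Strict Implicit.
Unset Printing Implicit Defensive.
Import Order.TTheory GRing.Theory Num.Theory.
Local Open Scope ring_scope.

(* Sites are numbered from 0: the index k : 'I_L is the (k+1)-st site of the
   chain, so the left boundary site has index 0 and the right one L - 1. *)
Definition config (L : nat) := {ffun 'I_L -> bool}.

Definition set_site (L : nat) (eta : config L) (i : 'I_L) (b : bool)
  : config L := [ffun k => if k == i then b else eta k].

Section Process.
Variables (R : realType) (L : nat) (alpha beta : R).
Implicit Types (eta zeta : config L) (i j : 'I_L).

(* In the rates below, a boolean [b] is cast to the indicator [b%:R]. *)

(* The pair (i, j) is meant to be a bond, i.e. j = i + 1. *)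
Definition bulk_rate i j eta zeta : R :=
  [&& eta i, ~~ eta j
    & zeta == set_site (set_site eta i false) j true]%:R
  + [&& eta i, eta j
      & zeta == set_site (set_site eta i false) j false]%:R.

Definition left_rate i eta zeta : R :=
  alpha * (~~ eta i && (zeta == set_site eta i true))%:R
  + alpha * (eta i && (zeta == set_site eta i false))%:R.

Definition right_rate i eta zeta : R :=
  beta * (eta i && (zeta == set_site eta i false))%:R.

(* The contributions add up: for L = 1 the only site is at both boundaries,
   and 1 -> 0 has total rate alpha + beta. *)
Definition rate eta zeta : R :=
  \sum_(i < L) \sum_(j < L | j == i.+1 :> nat) bulk_rate i j eta zeta
  + \sum_(i < L | i == 0%N :> nat) left_rate i eta zeta
  + \sum_(i < L | i.+1 == L) right_rate i eta zeta.

(* Row eta, column zeta; the rows sum to 0. *)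
Definition generator eta zeta : R :=
  rate eta zeta - (zeta == eta)%:R * \sum_(omega : config L) rate eta omega.

Definition distribution (P : {ffun config L -> R}) : Prop :=
  (forall eta, 0 <= P eta) /\ \sum_(eta : config L) P eta = 1.

Definition stationary (P : {ffun config L -> R}) : Prop :=
  distribution P /\
  forall zeta, \sum_(eta : config L) P eta * generator eta zeta = 0.

Definition mean (P : {ffun config L -> R}) (f : config L -> R) : R :=
  \sum_(eta : config L) P eta * f eta.

(* [disorder i] is the product over the first i sites, i.e. those of
   (0-based) index k < i; it is meant for i <= L. *)
Definition disorder (i : nat) eta : R :=
  \prod_(k < L | (k < i)%N) (1 - 2 * (eta k)%:R).

End Process.

Arguments disorder R {L} i eta.

(* Main.v *)
(** Applied to the disorder variable of the first n + 1 sites, the generator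
    only sees moves changing the parity of the particle number on those sites:
    the left reservoir flips it at rate alpha, bonds inside or outside the
    block conserve it, and an occupied last site of the block empties at total
    rate c, where c = 1 if the site has a right neighbour (10 -> 01 and
    11 -> 00 are equally fast) and c = beta at the right end.  Since
    -2 eta xi = xi' - xi, with xi' the disorder variable of one site fewer,
    stationarity gives the closed recursion (c + 2 alpha) <xi> = c <xi'>. *)
Require Import Defs.
From HB Require Import structures.
From mathcomp Require Import all_boot all_order all_algebra.
From mathcomp Require Import reals ring lra.
Set Implicit Arguments.
Unset Strict Implicit.
Unset Printing Implicit Defensive.
Import Order.TTheory GRing.Theory Num.Theory.
Local Open Scope ring_scope.

Lemma set_site_neq (L : nat) (eta : config L) (i k : 'I_L) (b : bool) :
  k != i -> set_site eta i b k = eta k.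
Proof. by move=> /negPf ki; rewrite ffunE ki. Qed.

Lemma sum_jump (R : pzRingType) (T : finType) (b : bool) (z : T) (g : T -> R) :
  \sum_(w : T) (b && (w == z))%:R * g w = b%:R * g z.
Proof.
rewrite (bigD1 z) //= eqxx andbT big1 ?addr0 // => w /negPf wz.
by rewrite wz andbF mul0r.
Qed.

Section Disorder.
Variables (R : realType) (L : nat).
Implicit Types (eta : config L) (i j : 'I_L).

Lemma disorder0 eta : disorder R 0 eta = 1.
Proof. by rewrite /disorder big_pred0. Qed.

Lemma disorderS i eta :
  disorder R i.+1 eta = disorder R i eta * (1 - 2 * (eta i)%:R).
Proof.
rewrite /disorder (bigD1 i) //= mulrC; congr (_ * _).
by apply: eq_bigl => k; rewrite ltnS ltn_neqAle andbC.
Qed.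

(** The hypothesis makes [set_site] a genuine flip, which negates one factor of the product if [i]
    lies in the block and none otherwise. *)
Lemma disorder_flip n i b eta :
  eta i = ~~ b ->
  disorder R n (set_site eta i b) = (-1) ^+ (i < n)%N * disorder R n eta.
Proof.
move=> etai; rewrite /disorder; case: ltnP => [lt_in | le_ni].
  rewrite (bigD1 i) //= [in RHS](bigD1 i) //= ffunE eqxx etai mulrA.
  congr (_ * _); first by case: b {etai} => /=; ring.
  by apply: eq_bigr => k /andP[_ ki]; rewrite set_site_neq.
rewrite mul1r; apply: eq_bigr => k lt_kn; rewrite set_site_neq //.
by apply: contraTneq lt_kn => ->; rewrite -leqNgt.
Qed.

Lemma disorder_flip2 n i j b c eta :
  j != i -> eta i = ~~ b -> eta j = ~~ c ->
  disorder R n (set_site (set_site eta i b) j c)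
    = (-1) ^+ (j < n)%N * (-1) ^+ (i < n)%N * disorder R n eta.
Proof.
move=> ji etai etaj; rewrite disorder_flip ?set_site_neq //.
by rewrite disorder_flip // mulrA.
Qed.

End Disorder.

Section Drift.
Variables (R : realType) (L : nat) (alpha beta : R).
Implicit Types (eta : config L) (i j k : 'I_L) (n : nat).

(** Both moves of a bond flip both of its ends, so the two signs cancel unless the block ends
    exactly between [i] and [j]. *)
Lemma bulk_drift n i j eta :
  j = i.+1 :> nat ->
  \sum_zeta bulk_rate R i j eta zeta * (disorder R n zeta - disorder R n eta)
    = - 2 * (i.+1 == n)%:R * (eta i)%:R * disorder R n eta.
Proof.
move=> ji; have neq_ji : j != i by rewrite -val_eqE /= ji gtn_eqF.
under eq_bigr do rewrite mulrDl !andbA.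
rewrite big_split /= !sum_jump.
have sgn : (-1) ^+ (j < n)%N * (-1) ^+ (i < n)%N
             = 1 - 2 * (i.+1 == n)%:R :> R.
  by rewrite ji; case: ltngtP => _ /=; ring.
case etai: (eta i); case etaj: (eta j); rewrite /= ?mul0r ?add0r ?addr0;
  by rewrite ?disorder_flip2 ?etai ?etaj // ?sgn; ring.
Qed.

(** Creation and annihilation share the rate [alpha], so a flip always has this rate and no factor
    [eta i] appears. *)
Lemma left_drift n i eta :
  \sum_zeta left_rate alpha i eta zeta * (disorder R n zeta - disorder R n eta)
    = - 2 * alpha * (i < n)%N%:R * disorder R n eta.
Proof.
under eq_bigr do rewrite mulrDl -!mulrA.
rewrite big_split /= -!mulr_sumr !sum_jump.
case etai: (eta i); rewrite /= ?mul0r ?mulr0 ?add0r ?addr0;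
  by rewrite disorder_flip ?etai //; case: (i < n)%N => /=; ring.
Qed.

Lemma right_drift n i eta :
  \sum_zeta right_rate beta i eta zeta * (disorder R n zeta - disorder R n eta)
    = - 2 * beta * (i < n)%N%:R * (eta i)%:R * disorder R n eta.
Proof.
under eq_bigr do rewrite -!mulrA.
rewrite -!mulr_sumr !sum_jump.
case etai: (eta i); rewrite /= ?mul0r ?mulr0 ?mul0r //.
by rewrite disorder_flip ?etai //; case: (i < n)%N => /=; ring.
Qed.

Definition exit_rate n : R := if (n.+1 < L)%N then 1 else beta.

Lemma disorder_drift k eta :
  \sum_zeta rate alpha beta eta zeta
      * (disorder R k.+1 zeta - disorder R k.+1 eta)
    = exit_rate k * disorder R k eta
      - (exit_rate k + 2 * alpha) * disorder R k.+1 eta.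
Proof.
under eq_bigr do rewrite /rate !mulrDl !mulr_suml.
rewrite !big_split /=.
under eq_bigr do under eq_bigr do rewrite mulr_suml.
rewrite exchange_big /= [X in _ + X + _]exchange_big [X in _ + _ + X]exchange_big.
have L_gt0 : (0 < L)%N by case: (L) k => [[]|].
rewrite [X in _ + X + _](big_pred1 (Ordinal L_gt0)) //= left_drift.
under eq_bigr do rewrite exchange_big /=.
under eq_bigr do under eq_bigr => j /eqP ji do rewrite bulk_drift //.
(* Only a bond starting at [k] can cross the edge of the block of [k.+1] sites. *)
rewrite (bigD1 k) //= [X in _ + X + _ + _]big1 ?addr0; last first.
  move=> i ik; rewrite big1 // => j _.
  by rewrite eqSS (negPf (ik : val i != val k)) mulr0 !mul0r.
under [X in _ + X]eq_bigr do rewrite right_drift.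
rewrite eqxx /exit_rate disorderS.
(* With [e] the occupation of [k], this gives [e * (1 - 2 * e) = - e], which linearizes the exit
   term. *)
have idem : (eta k)%:R * (eta k)%:R = (eta k)%:R :> R.
  by case: (eta k); rewrite ?mulr1 ?mulr0.
case: ltnP => [lt_kL | le_Lk].
  (* The bond to the right of [k] exists, and the right reservoir acts outside the block. *)
  rewrite (big_pred1 (Ordinal lt_kL)) // big1; last first.
    by move=> i /eqP iL; rewrite ltnS leqNgt -ltnS iL lt_kL mulr0 !mul0r.
  by rewrite /=; ring: idem.
have kL : k.+1 = L by apply/eqP; rewrite eqn_leq ltn_ord.
(* Here [k] is the last site: no bond leaves the block, and the right reservoir acts on [k]. *)
rewrite big_pred0; last by move=> j; rewrite kL ltn_eqF.
rewrite (big_pred1 k); last first.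
  by move=> i; rewrite /= -(congr1 (eq_op i.+1) kL) eqSS.
by rewrite ltnSn /=; ring: idem.
Qed.

End Drift.

(** Pairing the stationarity equations with [f] and exchanging the sums lets the generator act on
    [f]; its diagonal part yields the [- f eta]. *)
Lemma stationary_drift (R : realType) (L : nat) (alpha beta : R)
    (P : {ffun config L -> R}) (f : config L -> R) :
  stationary alpha beta P ->
  mean P (fun eta => \sum_zeta rate alpha beta eta zeta * (f zeta - f eta)) = 0.
Proof.
move=> [_ statP].
have : \sum_zeta (\sum_eta P eta * generator alpha beta eta zeta) * f zeta = 0.
  by rewrite big1 // => zeta _; rewrite statP mul0r.
under eq_bigr do rewrite mulr_suml.
rewrite exchange_big /= => drift0; rewrite -[RHS]drift0; apply: eq_bigr => eta _.
under [RHS]eq_bigr do rewrite -mulrA.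
rewrite -mulr_sumr; congr (_ * _); rewrite /generator.
under eq_bigr do rewrite mulrBr.
under [RHS]eq_bigr do rewrite mulrBl -mulrA.
rewrite !sumrB; congr (_ - _).
by rewrite (@sum_jump _ _ true) mul1r mulr_suml.
Qed.

Lemma mean_disorderS (R : realType) (L : nat) (alpha beta : R)
    (P : {ffun config L -> R}) (n : nat) :
  stationary alpha beta P -> (n < L)%N ->
  (exit_rate L beta n + 2 * alpha) * mean P (disorder R n.+1)
    = exit_rate L beta n * mean P (disorder R n).
Proof.
move=> statP lt_nL; apply/esym/eqP; rewrite -subr_eq0; apply/eqP.
rewrite -[RHS](stationary_drift (disorder R n.+1) statP) /mean.
rewrite !mulr_sumr -sumrB; apply: eq_bigr => eta _.
by rewrite (disorder_drift alpha beta (Ordinal lt_nL)) /=; ring.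
Qed.

Theorem theorem5 (R : realType) (L : nat) (alpha beta : R)
    (P : {ffun config L -> R})
    (hL : (1 <= L)%N) (halpha : 0 < alpha) (hbeta : 0 < beta)
    (hP : stationary alpha beta P) :
  (forall i : nat, (1 <= i)%N -> (i < L)%N ->
     mean P (disorder R i) = 1 / (1 + 2 * alpha) ^+ i) /\
  mean P (disorder R L)
    = beta / ((beta + 2 * alpha) * (1 + 2 * alpha) ^+ (L - 1)).
Proof.
have a_neq0 : 1 + 2 * alpha != 0 by apply: lt0r_neq0; lra.
have b_neq0 : beta + 2 * alpha != 0 by apply: lt0r_neq0; lra.
(* Including [i = 0], where the claim is the normalization of [P], starts the induction and also
   covers [L = 1] below. *)
have bulk i : (i < L)%N -> mean P (disorder R i) = 1 / (1 + 2 * alpha) ^+ i.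
  elim: i => [_ | i IHi lt_iL].
    rewrite expr0 divr1 -hP.1.2; apply: eq_bigr => eta _.
    by rewrite disorder0 mulr1.
  apply: (mulfI a_neq0); have := mean_disorderS hP (ltnW lt_iL).
  rewrite /exit_rate lt_iL mul1r IHi ?(ltnW lt_iL) // => ->.
  by rewrite exprS; field; rewrite a_neq0 expf_neq0.
split=> [i _|]; first exact: bulk.
case: L P hL hP bulk => // n P _ hP bulk.
(* The last step of the recursion has exit rate [beta] in place of 1. *)
apply: (mulfI b_neq0); have := mean_disorderS hP (ltnSn n).
rewrite /exit_rate ltnn (bulk n) // => ->.
by rewrite subn1 /=; field; rewrite b_neq0 expf_neq0.
Qed.
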